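(* Let $(A,B)$ be an invertible Jones pair of $n\times n$ complex matrices with $A$ symmetric. Then the space \[ \mathcal B=\{\mathcal M(F,G,H) : F\in\mathcal N_A,\ G,H\in\mathcal N_{A,B}\} \] of $4n\times 4n$ matrices is a Bose–Mesner algebra, and $\dim\mathcal B = 3\dim \mathcal N_A$.
   Context: All matrices are complex. For $n\times n$ matrices $X,Y$, $X\circ Y$ is the entrywise (Schur) product; if $X$ has no zero entry, $X^{(-)}$ is its Schur inverse, $(X^{(-)})_{ij}=1/X_{ij}$. $J_n$ is the all-ones $n\times n$ matrix and $e_1,\dots,e_n$ is the standard basis of $\mathbb C^n$. An $n\times n$ matrix $W$ is type-II if $W(W^{(-)})^T=nI$. For an $n\times n$ matrix $C$ define linear operators on $M_n(\mathbb C)$ by $X_C(M)=CM$ and $\Delta_C(M)=C\circ M$. A Jones pair is a pair $(A,B)$ of $n\times n$ matrices such that $X_A$ and $\Delta_B$ are invertible, $X_A\Delta_BX_A=\Delta_BX_A\Delta_B$ and $X_A\Delta_{B^T}X_A=\Delta_{B^T}X_A\Delta_{B^T}$; it is invertible if moreover $A$ has no zero entry and $B$ is invertible (equivalently, $A$ and $B$ are both type-II). For $n\times n$ matrices $P,Q$ with $P$ invertible and $Q$ without zero entries, $\mathcal N_{P,Q}$ is the set of $n\times n$ matrices $M$ such that every vector $Pe_i\circ Qe_j$ ($1\le i,j\le n$) is an eigenvector of $M$, and for $M\in\mathcal N_{P,Q}$, $\Theta_{P,Q}(M)$ is the $n\times n$ matrix with $M(Pe_i\circ Qe_j)=\Theta_{P,Q}(M)_{ij}\,(Pe_i\circ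 Qe_j)$. For a type-II matrix $P$, $\mathcal N_P:=\mathcal N_{P,P^{(-)}}$ and $\Theta_P:=\Theta_{P,P^{(-)}}$. Standing facts (for an invertible Jones pair $(A,B)$ with $A$ symmetric) needed for the definitions below to make sense: $\mathcal N_{A,B}=\mathcal N_{A,B^T}$ is closed under transposition, and $\mathcal N_A=\mathcal N_{B^{(-)}}$. Pairing: for $H\in\mathcal N_{A,B}$, the matrix paired with $H$ is the unique $n\times n$ matrix $K$ with $K^T\in\mathcal N_{A,B^T}$ and $\Theta_{A,B}(H)=\Theta_{A,B^T}(K^T)^T$. For $F\in\mathcal N_A$ and $G,H\in\mathcal N_{A,B}$, with $K$ paired with $H$, define the $4n\times4n$ block matrix \[ \mathcal M(F,G,H)=\begin{pmatrix} \Theta_A(F)+H & \Theta_A(F)-H & \Theta_{A,B}(G) & \Theta_{A,B}(G)\\ \Theta_A(F)-H & \Theta_A(F)+H & \Theta_{A,B}(G) & \Theta_{A,B}(G)\\ \Theta_{A,B}(G^T)^T & \Theta_{A,B}(G^T)^T & \Theta_{B^{(-)}}(F)+K & \Theta_{B^{(-)}}(F)-K\\ \Theta_{A,B}(G^T)^T & \Theta_{A,B}(G^T)^T & \Theta_{B^{(-)}}(F)-K & \Theta_{B^{(-)}}(F)+K \end{pmatrix}. \] A Bose–Mesner algebra is a complex vector space of square matrices of a fixed order that contains $I$ and $J$, is closed under transposition and under the Schur product, and is a commutative algebra under matrix multiplication. *)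

(* Defs.v *)
From mathcomp Require Import all_boot all_order all_algebra.
From mathcomp Require Import boolp classical_sets reals.
From mathcomp Require Import complex.

Set Implicit Arguments.
Unset Strict Implicit.
Unset Printing Implicit Defensive.

Import GRing.Theory.
Local Open Scope classical_set_scope.
Local Open Scope ring_scope.

Section SchurProduct.
Variable K : fieldType.

Definition schur m n (X Y : 'M[K]_(m, n)) : 'M[K]_(m, n) :=
  \matrix_(i, j) (X i j * Y i j).

Definition schur_inv m n (X : 'M[K]_(m, n)) : 'M[K]_(m, n) :=
  \matrix_(i, j) (X i j)^-1.

Definition no_zero_entry m n (X : 'M[K]_(m, n)) : Prop :=
  forall i j, X i j != 0.

End SchurProduct.

Section JonesPair.
Variables (K : fieldType) (n : nat).

Definition X_op (C M : 'M[K]_n) : 'M[K]_n := C *m M.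

Definition Delta_op (C M : 'M[K]_n) : 'M[K]_n := schur C M.

Definition Jones_pair (A B : 'M[K]_n) : Prop :=
  [/\ bijective (X_op A), bijective (Delta_op B),
      X_op A \o Delta_op B \o X_op A =1 Delta_op B \o X_op A \o Delta_op B
    & X_op A \o Delta_op B^T \o X_op A
        =1 Delta_op B^T \o X_op A \o Delta_op B^T].

Definition invertible_Jones_pair (A B : 'M[K]_n) : Prop :=
  [/\ Jones_pair A B, no_zero_entry A & B \in unitmx].

End JonesPair.

Section NomuraAlgebra.
Variables (K : fieldType) (n : nat).
Implicit Types (P Q M A B F G H L : 'M[K]_n).

Definition eigenvector M (v : 'cV[K]_n) : Prop :=
  v != 0 /\ exists a : K, M *m v = a *: v.

(* col i P is P e_i. *)
Definition col_schur P Q (i j : 'I_n) : 'cV[K]_n :=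
  schur (col i P) (col j Q).

Definition Nomura P Q : set 'M[K]_n :=
  [set M | forall i j, eigenvector M (col_schur P Q i j)].

(* [xget 0] picks the eigenvalue, which exists and is unique when M is in
   Nomura P Q (ThetaP, Theta_unique); outside Nomura P Q the value of Theta
   is meaningless. *)
Definition Theta P Q M : 'M[K]_n :=
  \matrix_(i, j)
    xget 0 [set a | M *m col_schur P Q i j = a *: col_schur P Q i j].

Lemma ThetaP P Q M i j : Nomura P Q M ->
  M *m col_schur P Q i j = Theta P Q M i j *: col_schur P Q i j.
Proof.
move=> /(_ i j) [_ [a Ma]]; rewrite mxE.
by case: xgetP => [b _ //|/(_ a)]; case.
Qed.

Lemma Theta_unique P Q M (T : 'M[K]_n) : Nomura P Q M ->
  (forall i j, M *m col_schur P Q i j = T i j *: col_schur P Q i j) ->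
  T = Theta P Q M.
Proof.
move=> NM TM; apply/matrixP => i j; have [v_neq0 _] := NM i j.
have /eqP := TM i j; rewrite (ThetaP i j NM) -subr_eq0 -scalerBl scaler_eq0.
by rewrite (negbTE v_neq0) orbF subr_eq0 => /eqP.
Qed.

Definition Nomura1 P : set 'M[K]_n := Nomura P (schur_inv P).

Definition Theta1 P M : 'M[K]_n := Theta P (schur_inv P) M.

Definition is_paired A B H L : Prop :=
  Nomura A B^T L^T /\ Theta A B H = (Theta A B^T L^T)^T.

(* For an invertible Jones pair (A, B) with A symmetric, every H in Nomura A B
   is paired with exactly one matrix; [xget 0] names it. *)
Definition paired A B H : 'M[K]_n := xget 0 [set L | is_paired A B H L].

Definition Mblock A B F G H : 'M[K]_(n + n + (n + n)) :=
  let L := paired A B H in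
  let TA := Theta1 A F in
  let TB := Theta1 (schur_inv B) F in
  let TG := Theta A B G in
  let TG' := (Theta A B G^T)^T in
  block_mx
    (block_mx (TA + H) (TA - H)
              (TA - H) (TA + H))   (block_mx TG TG
                                             TG TG)
    (block_mx TG' TG'
              TG' TG')             (block_mx (TB + L) (TB - L)
                                             (TB - L) (TB + L)).

Definition Bspace A B : set 'M[K]_(n + n + (n + n)) :=
  [set X | exists F G H,
    [/\ Nomura1 A F, Nomura A B G, Nomura A B H & X = Mblock A B F G H]].

End NomuraAlgebra.

Section BoseMesner.
Variables (K : fieldType) (m : nat).
Implicit Types (S : set 'M[K]_m) (X Y : 'M[K]_m).

Definition linear_subspace S : Prop :=
  S 0 /\ forall (a : K) X Y, S X -> S Y -> S (a *: X + Y).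

Definition Bose_Mesner S : Prop :=
  [/\ linear_subspace S,
      S 1%:M /\ S (const_mx 1),
      forall X, S X -> S X^T,
      forall X Y, S X -> S Y -> S (schur X Y)
    & forall X Y, S X -> S Y -> S (X *m Y) /\ X *m Y = Y *m X].

Definition has_dim S (d : nat) : Prop :=
  exists V : {vspace 'M[K]_m}, (forall X, X \in V <-> S X) /\ \dim V = d.

End BoseMesner.

(* Main.v *)
(** Write [N] for [N_A], [tau] for [Theta_A] and [A'] for the Schur inverse.
    The braid relations say that [A] lies in [N_{A,B}] and [N_{A,B^T}] with
    [Theta]-images [B] and [B^T]; taking traces shows that [A] and [B] are
    type-II.  The inverse of a type-II matrix is its transposed Schur inverse
    over [n], so a relation [M (P e_i o Q e_j) = T_ij (R e_i o S e_j)] can be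
    exchanged for one carried by [T^T].  Applied to the braid relations
    this shows that [B] maps the eigenvectors [A e_k o A' e_l] of [N] to those
    of [N_{B'}], so that conjugation by [B] is an automorphism [rho^-1] of [N]
    commuting with [tau]; moreover [B B^T = B^T B] lies in [N].  It also gives
    [N_{A,B} = A o N] and [Theta_{A,B}(A o V) = n^-1 tau(V) B], and [A o V] is
    paired with [A o rho V].  Hence the space of the theorem consists of the
    matrices with blocks
    [T +- A o V], [U B], [B^T U], [rho T +- A o rho V], for [T U V] in [N],
    where all closure properties reduce to those of [N]. *)

Require Import Defs.
From HB Require Import structures.
From mathcomp Require Import all_boot all_order all_algebra.
From mathcomp Require Import boolp classical_sets reals.
From mathcomp Require Import complex.
From mathcomp Require Import ring.

Set Implicit Arguments.
Unset Strict Implicit.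
Unset Printing Implicit Defensive.

Import GRing.Theory Num.Theory.
Local Open Scope ring_scope.

(** * Subspaces of matrices and their dimensions *)

Section Subspaces.
Variable K : fieldType.

(** A [V] of maximal dimension inside [S] is all of [S]: adjoining the line of some [X] in [S]
    cannot raise its dimension. *)
Lemma linear_subspace_vspace m (S : set 'M[K]_m) :
  linear_subspace S -> exists V : {vspace 'M[K]_m}, forall X, X \in V <-> S X.
Proof.
move=> [S0 SD].
pose P k := `[< exists V : {vspace 'M[K]_m},
  (forall X, X \in V -> S X) /\ \dim V = k >].
have exP : exists k, P k.
  exists 0%N; apply/asboolP; exists 0%VS; split; last exact: dimv0.
  by move=> X; rewrite memv0 => /eqP->.
have bP k : P k -> (k <= \dim (fullv : {vspace 'M[K]_m}))%N.
  by move=> /asboolP[V [_ <-]]; apply/dimvS/subvf.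
case: (ex_maxnP exP bP) => k /asboolP[V [VS dimV]] maxk.
exists V => X; split; first exact: VS.
move=> SX; have sVVX : (V <= V + <[X]>)%VS by apply: addvSl.
suff : V == (V + <[X]>)%VS.
  by move=> /eqP->; apply: (subvP (addvSr _ _)); rewrite memv_line.
rewrite eqEdim sVVX dimV; apply: maxk; apply/asboolP.
exists (V + <[X]>)%VS; split=> // Y /memv_addP[v Vv [w /vlineP[a ->] ->]].
by rewrite addrC; apply: SD => //; apply: VS.
Qed.

Lemma lfun_of_linear (U V : vectType K) (f : U -> V) :
  linear f -> exists g : 'Hom(U, V), g =1 f.
Proof.
move=> lin_f; pose L := GRing.isLinear.Build K U V *:%R f lin_f.
pose ff : {linear U -> V} := HB.pack f L.
by exists (linfun ff) => x; rewrite lfunE.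
Qed.

(** Joint injectivity gives each image dimension [d] and makes the three images independent, so the
    dimensions add up. *)
Lemma has_dim_image3 m p (S : set 'M[K]_m) d (f g h : 'M[K]_m -> 'M[K]_p) :
  linear f -> linear g -> linear h ->
  (forall X Y Z, f X + g Y + h Z = 0 -> [/\ X = 0, Y = 0 & Z = 0]) ->
  has_dim S d ->
  has_dim [set M | exists X Y Z,
             [/\ S X, S Y, S Z & M = f X + g Y + h Z]]%classic (3 * d)%N.
Proof.
move=> /lfun_of_linear[f' f'E] /lfun_of_linear[g' g'E] /lfun_of_linear[h' h'E].
move=> inj [V [VS dimV]].
have f0 : f 0 = 0 by rewrite -f'E linear0.
have g0 : g 0 = 0 by rewrite -g'E linear0.
have h0 : h 0 = 0 by rewrite -h'E linear0.
exists (f' @: V + g' @: V + h' @: V)%VS; split.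
  move=> M; split.
    move=> /memv_addP[_ /memv_addP[_ /memv_imgP[X VX ->]
      [_ /memv_imgP[Y VY ->] ->]] [_ /memv_imgP[Z VZ ->] ->]].
    by exists X, Y, Z; rewrite -f'E -g'E -h'E; split=> //; apply/VS.
  move=> [X [Y [Z [/VS VX /VS VY /VS VZ ->]]]].
  by rewrite -f'E -g'E -h'E !memv_add ?memv_img.
have dim_img (q : 'Hom('M[K]_m, 'M[K]_p)) :
    (forall X, q X = 0 -> X = 0) -> \dim (q @: V) = d.
  move=> q0; rewrite -dimV; apply: limg_dim_eq; apply/eqP; rewrite -subv0.
  apply/subvP => X; rewrite memv_cap memv_ker => /andP[_ /eqP/q0->].
  exact: mem0v.
rewrite dimv_disjoint_sum ?dimv_disjoint_sum ?dim_img //.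
- by rewrite !mulSn mul0n addn0 addnA.
- by move=> Z; rewrite h'E => hZ; case: (inj 0 0 Z) => //;
  rewrite f0 g0 hZ !addr0.
- by move=> Y; rewrite g'E => gY; case: (inj 0 Y 0) => //;
  rewrite f0 h0 gY !addr0.
- by move=> X; rewrite f'E => fX; case: (inj X 0 0) => //;
  rewrite g0 h0 fX !addr0.
- apply/eqP; rewrite -subv0; apply/subvP => M; rewrite memv_cap.
  move=> /andP[/memv_imgP[X VX ->] /memv_imgP[Y VY]]; rewrite f'E g'E => E.
  have [|-> _ _] := inj X (- Y) 0; last by rewrite f0 mem0v.
  by rewrite -g'E linearN /= g'E E h0 addr0 subrr.
- apply/eqP; rewrite -subv0; apply/subvP => M; rewrite memv_cap.
  move=> /andP[/memv_addP[_ /memv_imgP[X VX ->] [_ /memv_imgP[Y VY ->] ->]]].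
  move=> /memv_imgP[Z VZ]; rewrite f'E g'E h'E => E.
  have [|-> -> _] := inj X Y (- Z); last by rewrite f0 g0 addr0 mem0v.
  by rewrite -h'E linearN /= h'E E subrr.
Qed.

End Subspaces.

(** * Elementary rules for the Schur product *)

Section Schur.
Variables (K : fieldType) (m n : nat).
Implicit Types X Y Z : 'M[K]_(m, n).

Lemma schurC X Y : schur X Y = schur Y X.
Proof. by apply/matrixP => i j; rewrite !mxE mulrC. Qed.

Lemma schur_linear X : linear (schur X).
Proof. by move=> a Y Z; apply/matrixP => i j; rewrite !mxE; ring. Qed.

Lemma schurZr a X Y : schur X (a *: Y) = a *: schur X Y.
Proof. by apply/matrixP => i j; rewrite !mxE; ring. Qed.

Lemma schurZl a X Y : schur (a *: X) Y = a *: schur X Y.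
Proof. by apply/matrixP => i j; rewrite !mxE; ring. Qed.

Lemma schur0 X : schur X 0 = 0.
Proof. by apply/matrixP => i j; rewrite !mxE mulr0. Qed.

Lemma schur_invK X : schur_inv (schur_inv X) = X.
Proof. by apply/matrixP => i j; rewrite !mxE invrK. Qed.

Lemma schur_inv_neq0 X : no_zero_entry X -> no_zero_entry (schur_inv X).
Proof. by move=> X0 i j; rewrite mxE invr_eq0. Qed.

Lemma schurK X Y : no_zero_entry X -> schur X (schur (schur_inv X) Y) = Y.
Proof. by move=> X0; apply/matrixP => i j; rewrite !mxE mulVKf. Qed.

Lemma schurVK X Y : no_zero_entry X -> schur (schur_inv X) (schur X Y) = Y.
Proof. by move=> X0; apply/matrixP => i j; rewrite !mxE mulKf. Qed.

End Schur.

Lemma tr_schur (K : fieldType) m n (X Y : 'M[K]_(m, n)) :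
  (schur X Y)^T = schur X^T Y^T.
Proof. by apply/matrixP => i j; rewrite !mxE. Qed.

Lemma tr_schur_inv (K : fieldType) m n (X : 'M[K]_(m, n)) :
  (schur_inv X)^T = schur_inv X^T.
Proof. by apply/matrixP => i j; rewrite !mxE. Qed.

Lemma tr_neq0 (K : fieldType) m n (X : 'M[K]_(m, n)) :
  no_zero_entry X -> no_zero_entry X^T.
Proof. by move=> X0 i j; rewrite mxE. Qed.

(** * Intertwining relations, and the exchange of operator and scalars *)

Section Intertwining.
Variables (K : fieldType) (n : nat).
Hypothesis n_neq0 : n%:R != 0 :> K.
Implicit Types M P Q T : 'M[K]_n.

(** Nonzero entries are required separately because [schur_inv] sends a zero entry to zero. *)
Definition type_II P := no_zero_entry P /\ P *m (schur_inv P)^T = n%:R%:M.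

Lemma type_II_tr P : type_II P -> type_II P^T.
Proof.
move=> [P0 PP]; split; first exact: tr_neq0.
have : P *m (n%:R^-1 *: (schur_inv P)^T) = 1%:M.
  by rewrite -scalemxAr PP scale_scalar_mx mulVf.
move=> /mulmx1C; rewrite -scalemxAl => E.
have /(congr1 (fun X => (n%:R *: X)^T)) := E.
rewrite scalerA divff // scale1r trmx_mul trmxK scale_scalar_mx mulr1.
by rewrite tr_scalar_mx -tr_schur_inv trmxK.
Qed.

Lemma type_II_inv P : type_II P -> type_II (schur_inv P).
Proof.
move=> [P0 PP]; split; first exact: schur_inv_neq0.
by rewrite schur_invK -[LHS]trmxK trmx_mul trmxK PP tr_scalar_mx.
Qed.

Lemma type_II_unit P : type_II P -> P \in unitmx.
Proof.
move=> [_ PP]; have : P *m (n%:R^-1 *: (schur_inv P)^T) = 1%:M.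
  by rewrite -scalemxAr PP scale_scalar_mx mulVf.
by move=> /mulmx1_unit[].
Qed.

(** Letting the target pair differ from the source pair also covers operators that carry the
    eigenvectors of one Nomura algebra to those of another. *)
Definition intertwines M P Q P' Q' T :=
  forall i j, M *m col_schur P Q i j = T i j *: col_schur P' Q' i j.

Lemma intertwinesP M P Q P' Q' T :
  intertwines M P Q P' Q' T <->
  forall i j k, \sum_l M k l * (P l i * Q l j) = T i j * (P' k i * Q' k j).
Proof.
split=> E i j; last first.
  apply/matrixP => k o; rewrite !mxE -E; apply: eq_bigr => l _.
  by rewrite !mxE.
move=> k; have := congr1 (fun v : 'cV_n => v k 0) (E i j); rewrite !mxE => <-.
by apply: eq_bigr => l _; rewrite !mxE.
Qed.

Lemma intertwines_swap M P Q P' Q' T :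
  intertwines M P Q P' Q' T -> intertwines M Q P Q' P' T^T.
Proof.
move=> E i j; rewrite mxE /col_schur schurC [in RHS]schurC; exact: E.
Qed.

Lemma intertwines_comp M1 M2 P Q P' Q' P'' Q'' T1 T2 :
  intertwines M1 P Q P' Q' T1 -> intertwines M2 P' Q' P'' Q'' T2 ->
  intertwines (M2 *m M1) P Q P'' Q'' (schur T1 T2).
Proof.
move=> E1 E2 i j.
by rewrite -mulmxA E1 -scalemxAr E2 scalerA mxE.
Qed.

Lemma intertwines_inv M P Q P' Q' T : M \in unitmx -> no_zero_entry T ->
  intertwines M P Q P' Q' T ->
  intertwines (invmx M) P' Q' P Q (schur_inv T).
Proof.
move=> uM T0 E i j; rewrite mxE; apply: (canRL (scalerK (T0 i j))).
by rewrite scalemxAr -E mulKmx.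
Qed.

Lemma intertwines_linear a M1 M2 P Q P' Q' T1 T2 :
  intertwines M1 P Q P' Q' T1 -> intertwines M2 P Q P' Q' T2 ->
  intertwines (a *: M1 + M2) P Q P' Q' (a *: T1 + T2).
Proof.
move=> E1 E2 i j.
by rewrite mulmxDl -scalemxAl E1 E2 !mxE scalerDl scalerA.
Qed.

Lemma intertwines_scale a M P Q P' Q' T :
  intertwines M P Q P' Q' T -> intertwines (a *: M) P Q P' Q' (a *: T).
Proof. by move=> E i j; rewrite -scalemxAl E scalerA mxE. Qed.

Lemma intertwines1 P Q : intertwines 1%:M P Q P Q (const_mx 1).
Proof. by move=> i j; rewrite mul1mx mxE scale1r. Qed.

Lemma intertwines_unique M P Q P' Q' T1 T2 :
  no_zero_entry P' -> no_zero_entry Q' ->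
  intertwines M P Q P' Q' T1 -> intertwines M P Q P' Q' T2 -> T1 = T2.
Proof.
move=> P0 Q0 /intertwinesP E1 /intertwinesP E2; apply/matrixP => i j.
have := E1 i j i; rewrite E2 => /esym; apply: mulIf.
by rewrite mulf_neq0.
Qed.

(* Multiplication by [P] on the right is undone, up to the factor [n], by
   [(schur_inv P)^T]. *)
Lemma exchange M P Q P' Q' T : type_II P -> no_zero_entry Q' ->
  intertwines M P Q P' Q' T <->
  intertwines T^T P'^T (schur_inv P)^T (schur_inv Q')^T Q^T (n%:R *: M).
Proof.
move=> [P0 PP] Q0; have [_ PP'] := type_II_tr (conj P0 PP).
(* For fixed [k] and [j] the relation is the row identity [x k j *m P = y k j]; the exchanged
   relation, multiplied by [Q' k j], is this identity solved for [x k j]. *)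
pose x k j := \row_l (M k l * Q l j) : 'rV[K]_n.
pose y k j := \row_i (T i j * (P' k i * Q' k j)) : 'rV[K]_n.
have PV : P^T *m schur_inv P = n%:R%:M by rewrite -PP' -tr_schur_inv trmxK.
have VP : (schur_inv P)^T *m P = n%:R%:M.
  by rewrite -[LHS]trmxK trmx_mul trmxK PV tr_scalar_mx.
have L : intertwines M P Q P' Q' T <-> forall k j, x k j *m P = y k j.
  split=> [/intertwinesP E k j|E]; last apply/intertwinesP => i j k.
    apply/rowP => i; rewrite !mxE -E; apply: eq_bigr => l _.
    by rewrite !mxE; ring.
  have := congr1 (fun v : 'rV_n => v 0 i) (E k j); rewrite !mxE => <-.
  by apply: eq_bigr => l _; rewrite !mxE; ring.
have R : intertwines T^T P'^T (schur_inv P)^T (schur_inv Q')^T Q^T (n%:R *: M)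
     <-> forall k j, y k j *m (schur_inv P)^T = n%:R *: x k j.
  split=> [/intertwinesP E k j|E]; last apply/intertwinesP => k l j.
    apply/rowP => l; have := E k l j; rewrite !mxE.
    move=> /(congr1 (fun z => z * Q' k j)).
    rewrite mulr_suml => E'.
    transitivity (n%:R * M k l * ((Q' k j)^-1 * Q l j) * Q' k j).
      by rewrite -E'; apply: eq_bigr => i _; rewrite !mxE; ring.
    by field.
  have := congr1 (fun v : 'rV_n => v 0 l) (E k j); rewrite !mxE => E'.
  apply: (mulIf (Q0 k j)); transitivity (n%:R * (M k l * Q l j)); last by field.
  rewrite -E' mulr_suml.
  by apply: eq_bigr => i _; rewrite !mxE; ring.
rewrite L R; split=> E k j.
  by rewrite -E -mulmxA PP mul_mx_scalar.
apply: (scalerI n_neq0); rewrite scalemxAl -E -mulmxA VP.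
by rewrite mul_mx_scalar.
Qed.

(** [exchange] makes [n M1] and [n M2] the scalars of one relation, and scalars are unique. *)
Lemma intertwines_inj M1 M2 P Q P' Q' T :
  type_II P -> no_zero_entry Q -> no_zero_entry Q' ->
  intertwines M1 P Q P' Q' T -> intertwines M2 P Q P' Q' T -> M1 = M2.
Proof.
move=> P2 Q0 Q'0 /(exchange _ _ _ _ P2 Q'0) E1 /(exchange _ _ _ _ P2 Q'0) E2.
apply: (scalerI n_neq0).
by apply: intertwines_unique E1 E2; apply/tr_neq0 => //; apply/schur_inv_neq0.
Qed.

Lemma Nomura_intertwines P Q M :
  Nomura P Q M -> intertwines M P Q P Q (Theta P Q M).
Proof. by move=> NM i j; apply: ThetaP. Qed.

Lemma intertwines_Nomura P Q M T : no_zero_entry P -> no_zero_entry Q ->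
  intertwines M P Q P Q T -> Nomura P Q M /\ Theta P Q M = T.
Proof.
move=> P0 Q0 E; have NM : Nomura P Q M.
  move=> i j; split; last by exists (T i j).
  apply/eqP => /matrixP/(_ i 0)/eqP; rewrite !mxE mulf_eq0.
  by rewrite (negbTE (P0 i i)) (negbTE (Q0 i j)).
by split=> //; apply: (intertwines_unique P0 Q0 _ E); apply: Nomura_intertwines.
Qed.

Lemma Nomura_mul P Q M1 M2 : no_zero_entry P -> no_zero_entry Q ->
  Nomura P Q M1 -> Nomura P Q M2 ->
  Nomura P Q (M1 *m M2) /\
  Theta P Q (M1 *m M2) = schur (Theta P Q M1) (Theta P Q M2).
Proof.
move=> P0 Q0 /Nomura_intertwines E1 /Nomura_intertwines E2.
by rewrite schurC; apply/intertwines_Nomura/intertwines_comp.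
Qed.

Lemma Theta_inj P Q M1 M2 : type_II P -> no_zero_entry Q ->
  Nomura P Q M1 -> Nomura P Q M2 -> Theta P Q M1 = Theta P Q M2 -> M1 = M2.
Proof.
move=> P2 Q0 /Nomura_intertwines E1 /Nomura_intertwines E2 T12.
rewrite T12 in E1.
exact: (intertwines_inj P2 Q0 Q0 E1 E2).
Qed.

End Intertwining.

(** * Both members of an invertible Jones pair are type-II *)

Section JonesTypeII.
Variables (K : fieldType) (n : nat).
Hypothesis n_neq0 : n%:R != 0 :> K.
Implicit Types A B : 'M[K]_n.

Lemma bijective_X_op_unit A : bijective (X_op A) -> A \in unitmx.
Proof. by case=> f _ fK; have [] := mulmx1_unit (fK 1%:M). Qed.

Lemma bijective_Delta_op_neq0 B : bijective (Delta_op B) -> no_zero_entry B.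
Proof.
case=> f fK _ i j; apply/eqP => Bij0.
have : Delta_op B (delta_mx i j) = Delta_op B 0.
  apply/matrixP => k l; rewrite !mxE; have [->|] := eqVneq k i.
    by have [->|] := eqVneq l j; rewrite ?mulr0 //= Bij0 mul0r.
  by rewrite !mulr0.
move=> /(congr1 f); rewrite !fK => /matrixP/(_ i j)/eqP.
by rewrite !mxE !eqxx oner_eq0.
Qed.

(** On the matrix unit [delta_mx i j] both sides live in column [j], where they are [A] applied to
    [A e_i o B e_j] and [B i j] times that vector. *)
Lemma braid_intertwines A B :
  X_op A \o Delta_op B \o X_op A =1 Delta_op B \o X_op A \o Delta_op B ->
  intertwines A A B A B B.
Proof.
move=> braid; apply/intertwinesP => i j k.
have /matrixP/(_ k j) := braid (delta_mx i j); rewrite !mxE => E.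
transitivity (\sum_l A k l * schur B (A *m delta_mx i j) l j).
  apply: eq_bigr => l _; rewrite !mxE (bigD1 i) //= big1.
    by rewrite mxE !eqxx /= mulr1 addr0; ring.
  by move=> m /negbTE m_i; rewrite mxE m_i mulr0.
rewrite E (bigD1 i) //= big1.
  by rewrite !mxE !eqxx /= mulr1 addr0; ring.
by move=> m /negbTE m_i; rewrite !mxE m_i /= !mulr0.
Qed.

(* The diagonal of [A^-1 D_j A = D_j A D_j^-1], where [D_j] is the diagonal
   matrix with entries [B e_j]. *)
Lemma Jones_diagonal A B : A \in unitmx -> no_zero_entry B ->
  intertwines A A B A B B ->
  schur (invmx A) A^T *m B = \matrix_(k, _) A k k.
Proof.
move=> uA B0 E; apply/matrixP => k j; rewrite !mxE.
have := congr1 (mulmx (invmx A)) (E k j).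
rewrite mulKmx // -scalemxAr => /matrixP/(_ k 0); rewrite !mxE => E'.
apply: (mulfI (B0 k j)); rewrite -[RHS]mulrC E'; congr (_ * _).
by apply: eq_bigr => l _; rewrite !mxE; ring.
Qed.

(** Each column of [schur (invmx A) A^T] sums to 1, by the diagonal of [A *m invmx A]; hence summing
    column [j] of [Jones_diagonal] gives the claim. *)
Lemma Jones_col_sum A B : A \in unitmx -> no_zero_entry B ->
  intertwines A A B A B B -> forall j, \sum_k B k j = \tr A.
Proof.
move=> uA B0 E j; have /matrixP D := Jones_diagonal uA B0 E.
transitivity (\sum_k \sum_l invmx A k l * A l k * B l j); last first.
  apply: eq_bigr => k _; have := D k j; rewrite !mxE => <-.
  by apply: eq_bigr => l _; rewrite !mxE.
rewrite exchange_big; apply: eq_bigr => l _ /=; rewrite -mulr_suml.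
have /matrixP/(_ l l) := mulmxV uA; rewrite !mxE eqxx => S1.
rewrite -[LHS]mul1r -[1]S1; congr (_ * _).
by apply: eq_bigr => k _; rewrite mulrC.
Qed.

(** With trace zero, the all-ones row would be killed by the invertible [B], so it would vanish
    together with the sum [n] of its entries. *)
Lemma Jones_trace_neq0 A B : A \in unitmx -> B \in unitmx ->
  no_zero_entry B -> intertwines A A B A B B -> \tr A != 0.
Proof.
move=> uA uB B0 E; have S := Jones_col_sum uA B0 E.
apply: contra_neq n_neq0 => t0.
have : (const_mx 1 : 'rV[K]_n) = 0.
  apply: (can_inj (mulmxK uB)); rewrite mul0mx; apply/rowP => j.
  by rewrite !mxE -[RHS]t0 -(S j); apply: eq_bigr => k _; rewrite mxE mul1r.
move=> /rowP E1; rewrite -{1}(card_ord n) -sumr_const.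
by apply: big1 => i _; have := E1 i; rewrite !mxE.
Qed.

(** By [Jones_diagonal] and the column sums, [\tr A *: e] and the matrix with constant rows [A k k]
    agree after multiplication by [B], so the rows of [e] are constant. They sum to 1, so every
    entry of [e] is [n^-1]. *)
Lemma Jones_type_II_left A B : A \in unitmx -> B \in unitmx ->
  no_zero_entry A -> no_zero_entry B ->
  intertwines A A B A B B -> type_II A.
Proof.
move=> uA uB A0 B0 E; split=> //; have S := Jones_col_sum uA B0 E.
have D := Jones_diagonal uA B0 E; set e := schur _ _ in D.
have t0 := Jones_trace_neq0 uA uB B0 E.
have eE k m : \tr A * e k m = A k k.
  have : \tr A *: e = \matrix_(k, _) A k k.
    apply: (can_inj (mulmxK uB)); rewrite -scalemxAl D; apply/matrixP => i j.
    rewrite !mxE -(S j) mulrC mulr_sumr.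
    by apply: eq_bigr => l _; rewrite mxE.
  by move=> /matrixP/(_ k m); rewrite !mxE.
have e1 k : \sum_m e k m = 1.
  have /matrixP/(_ k k) := mulVmx uA; rewrite !mxE eqxx => S1.
  by rewrite -[RHS]S1; apply: eq_bigr => m _; rewrite !mxE.
have en k m : n%:R * e k m = 1.
  apply: (mulfI t0); rewrite mulrCA eE mulr1.
  transitivity (\tr A * \sum_l e k l); last by rewrite e1 mulr1.
  rewrite mulr_sumr (eq_bigr (fun=> A k k)) //.
  by rewrite sumr_const card_ord mulr_natl.
have -> : (schur_inv A)^T = n%:R *: invmx A.
  apply/matrixP => k m; have := en k m; rewrite !mxE mulrA => E1.
  by apply: (mulIf (A0 m k)); rewrite E1 mulVf.
by rewrite -scalemxAr mulmxV // scale_scalar_mx mulr1.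
Qed.

(** For [B], sum the exchanged first relation over [j]. The rows of [B] all sum to [\tr A] by the
    second relation, so for [k != l] the left side is a multiple of an off-diagonal entry of
    [A *m (schur_inv A)^T], which is zero. *)
Lemma invertible_Jones_pair_type_II A B : invertible_Jones_pair A B ->
  [/\ type_II A, type_II B, intertwines A A B A B B
    & intertwines A A B^T A B^T B^T].
Proof.
case=> [[/bijective_X_op_unit uA /bijective_Delta_op_neq0 B0]].
move=> /braid_intertwines E1 /braid_intertwines E2 A0 uB.
have A2 := Jones_type_II_left uA uB A0 B0 E1; split=> //; split=> //.
have row_sum k : \sum_j B k j = \tr A.
  rewrite -(Jones_col_sum uA (tr_neq0 B0) E2 k).
  by apply: eq_bigr => j _; rewrite mxE.
have /(exchange n_neq0 _ _ _ _ A2 B0)/intertwinesP E := E1.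
apply/matrixP => l k; rewrite !mxE; have [->|k_l] := eqVneq l k.
  rewrite (eq_bigr (fun=> 1)); first by rewrite sumr_const card_ord.
  by move=> j _; rewrite !mxE divff.
have [_ AA] := A2; have /matrixP/(_ k l) := AA.
rewrite !mxE eq_sym (negbTE k_l) mulr0n => Akl.
have : \sum_j \sum_i B i j * (A k i * (A l i)^-1) =
       \sum_j n%:R * A k l * ((B k j)^-1 * B l j).
  apply: eq_bigr => j _; have := E k l j; rewrite !mxE => <-.
  by apply: eq_bigr => i _; rewrite !mxE.
rewrite exchange_big /= -mulr_sumr.
rewrite (eq_bigr (fun i => \tr A * (A k i * (A l i)^-1))); last first.
  by move=> i _; rewrite -mulr_suml row_sum.
rewrite -mulr_sumr (eq_bigr (fun i => A k i * (schur_inv A)^T i l)); last first.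
  by move=> i _; rewrite !mxE.
rewrite Akl mulr0 => /esym/eqP; rewrite !mulf_eq0 (negbTE n_neq0).
rewrite (negbTE (A0 k l)) => /eqP S0; rewrite -[RHS]S0.
by apply: eq_bigr => j _; rewrite !mxE mulrC.
Qed.

End JonesTypeII.

(** * The self-dual algebra [N_A] of a symmetric [A], and its conjugation by [B] *)

Section NomuraSymmetric.
Variables (K : fieldType) (n : nat).
Hypothesis n_neq0 : n%:R != 0 :> K.
Variable A : 'M[K]_n.
Hypotheses (hA : A^T = A) (A2 : type_II A).
Implicit Types B F G T : 'M[K]_n.

Local Notation A' := (schur_inv A).
Local Notation N := (Nomura1 A).
Local Notation tau := (Theta1 A).

Let A0 : no_zero_entry A := proj1 A2.
Let A'0 : no_zero_entry A' := schur_inv_neq0 A0.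

Lemma Nomura1_intertwines F : N F -> intertwines F A A' A A' (tau F).
Proof. exact: Nomura_intertwines. Qed.

Lemma intertwines_Nomura1 F T :
  intertwines F A A' A A' T -> N F /\ tau F = T.
Proof. exact: intertwines_Nomura. Qed.

Lemma Theta1_inj F G : N F -> N G -> tau F = tau G -> F = G.
Proof. exact: Theta_inj. Qed.

(** Exchange along [A']: since [A] is symmetric, the new relation is again about the vectors
    [A e_i o A' e_j], with [tau F] as the operator. *)
Lemma Nomura1_Theta1 F : N F -> N (tau F) /\ tau (tau F) = n%:R *: F^T.
Proof.
move=> /Nomura1_intertwines/intertwines_swap.
move=> /(exchange n_neq0 _ _ _ _ (type_II_inv A2) A0).
rewrite schur_invK trmxK tr_schur_inv hA => /intertwines_swap.
by rewrite linearZ => /intertwines_Nomura1.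
Qed.

Lemma Nomura1_linear a F G : N F -> N G ->
  N (a *: F + G) /\ tau (a *: F + G) = a *: tau F + tau G.
Proof.
move=> /Nomura1_intertwines EF /Nomura1_intertwines EG.
exact/intertwines_Nomura1/intertwines_linear.
Qed.

Lemma Nomura1_0 : N 0.
Proof.
have [|//] := @intertwines_Nomura1 0 0.
by move=> i j; rewrite mul0mx mxE scale0r.
Qed.

Lemma Nomura1_scale a F : N F -> N (a *: F) /\ tau (a *: F) = a *: tau F.
Proof.
by move=> /Nomura1_intertwines EF; apply/intertwines_Nomura1/intertwines_scale.
Qed.

Lemma Nomura1_add F G : N F -> N G -> N (F + G).
Proof.
by move=> NF NG; have [] := Nomura1_linear 1 NF NG; rewrite scale1r.
Qed.

Lemma Nomura1_1 : N 1%:M /\ tau 1%:M = const_mx 1.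
Proof. exact/intertwines_Nomura1/intertwines1. Qed.

(** [F^T] is [n^-1 tau (tau F)], so the duality is iterated. *)
Lemma Nomura1_tr F : N F -> N F^T /\ tau F^T = (tau F)^T.
Proof.
move=> NF; have [NT TT] := Nomura1_Theta1 NF.
have [NTT TTT] := Nomura1_Theta1 NT.
have FT : F^T = n%:R^-1 *: tau (tau F) by rewrite TT scalerA mulVf // scale1r.
have [NFT tauFT] := Nomura1_scale n%:R^-1 NTT; rewrite -FT in NFT tauFT.
by split=> //; rewrite tauFT TTT scalerA mulVf // scale1r.
Qed.

Lemma Nomura1_mul F G :
  N F -> N G -> N (F *m G) /\ tau (F *m G) = schur (tau F) (tau G).
Proof. exact: Nomura_mul. Qed.

Lemma Nomura1_comm F G : N F -> N G -> F *m G = G *m F.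
Proof.
move=> NF NG; have [NFG tFG] := Nomura1_mul NF NG.
have [NGF tGF] := Nomura1_mul NG NF.
by apply: Theta1_inj => //; rewrite tFG tGF schurC.
Qed.

Lemma Theta1_surj T : N T -> exists2 F, N F & tau F = T.
Proof.
move=> /Nomura1_tr[NT _]; have [NtT ttT] := Nomura1_Theta1 NT.
have [NF tF] := Nomura1_scale n%:R^-1 NtT.
exists (n%:R^-1 *: tau T^T) => //.
by rewrite tF ttT trmxK scalerA mulVf // scale1r.
Qed.

Lemma Nomura1_schur F G : N F -> N G -> N (schur F G).
Proof.
move=> /Theta1_surj[F' NF' <-] /Theta1_surj[G' NG' <-].
have [NFG <-] := Nomura1_mul NF' NG'.
by have [] := Nomura1_Theta1 NFG.
Qed.

(** A form of the hypotheses that is symmetric in [B] and [B^T], so that every consequence holds for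
    both. *)
Definition Jones_data B :=
  [/\ type_II B, intertwines A A B A B B & intertwines A A B^T A B^T B^T].

Lemma Jones_data_tr B : Jones_data B -> Jones_data B^T.
Proof. by case=> B2 E1 E2; split; rewrite ?trmxK //; apply: type_II_tr. Qed.

Lemma Jones_intertwines_tr B : Jones_data B ->
  intertwines B^T A A' (schur_inv B)^T B^T (n%:R *: A).
Proof.
case=> [[B0 _]] E1 _; have := E1 => /(exchange n_neq0 _ _ _ _ A2 B0).
by rewrite tr_schur_inv hA.
Qed.

Lemma Jones_intertwines B : Jones_data B ->
  intertwines B A A' (schur_inv B) B (n%:R *: A).
Proof.
by move=> /Jones_data_tr/Jones_intertwines_tr; rewrite trmxK tr_schur_inv trmxK.
Qed.

(** Exchanging the first relation along [B] instead of [A] gives a way back for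
    [Jones_intertwines_tr]; the composite shows that [B *m B^T] lies in [N]. *)
Lemma Jones_intertwines_back B : Jones_data B ->
  intertwines B (schur_inv B)^T B^T A A' (n%:R *: A).
Proof.
case=> B2 /intertwines_swap E1 _; have := E1.
move=> /(exchange n_neq0 _ _ _ _ B2 A0)/intertwines_swap.
by rewrite trmxK (tr_schur_inv A) hA linearZ /= hA.
Qed.

Lemma scaled_neq0 : no_zero_entry (n%:R *: A).
Proof. by move=> i j; rewrite mxE mulf_neq0. Qed.

Lemma schur_scaled_conj T :
  schur (schur (schur_inv (n%:R *: A)) T) (n%:R *: A) = T.
Proof. by rewrite schurC schurK //; apply: scaled_neq0. Qed.

Lemma Nomura1_mulmx_tr B : Jones_data B ->
  N (B *m B^T) /\ tau (B *m B^T) = n%:R ^+ 2 *: schur A A.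
Proof.
move=> JB.
have := intertwines_comp (Jones_intertwines_tr JB) (Jones_intertwines_back JB).
move=> /intertwines_Nomura1; rewrite schurZl schurZr scalerA; exact.
Qed.

(** The [tau]-image of [B *m B^T] depends on [A] alone, so it is unchanged when [B] becomes
    [B^T]. *)
Lemma Jones_mulmx_trC B : Jones_data B -> B *m B^T = B^T *m B.
Proof.
move=> JB; have [NB tB] := Nomura1_mulmx_tr JB.
have [] := Nomura1_mulmx_tr (Jones_data_tr JB); rewrite trmxK => NB' tB'.
by apply: Theta1_inj => //; rewrite tB tB'.
Qed.

(** The scalars [n A] of [B] cancel against those of its inverse, so [T] is kept. *)
Lemma intertwines_conj B F T : Jones_data B -> intertwines F A A' A A' T ->
  intertwines (B *m F *m invmx B) (schur_inv B) B (schur_inv B) B T.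
Proof.
move=> JB EF; have [B2 _ _] := JB.
have J := Jones_intertwines JB.
have J' := intertwines_inv (type_II_unit n_neq0 B2) scaled_neq0 J.
have := intertwines_comp (intertwines_comp J' EF) J.
by rewrite mulmxA schur_scaled_conj.
Qed.

Lemma intertwines_conjV B F T : Jones_data B ->
  intertwines F (schur_inv B) B (schur_inv B) B T ->
  intertwines (invmx B *m F *m B) A A' A A' T.
Proof.
move=> JB EF; have [B2 _ _] := JB.
have J := Jones_intertwines JB.
have J' := intertwines_inv (type_II_unit n_neq0 B2) scaled_neq0 J.
have := intertwines_comp (intertwines_comp J EF) J'.
by rewrite mulmxA schurC schurVK //; apply: scaled_neq0.
Qed.

(* The duality [Theta_B'] between [N_B'] and [N_B'^T] takes the same values as
   [Theta_A], so both conjugates of [N_A] coincide with [N_A]. *)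
Lemma Nomura1_conj_dual B F : Jones_data B -> N F ->
  N (invmx B^T *m (tau F)^T *m B^T) /\
  tau (invmx B^T *m (tau F)^T *m B^T) = n%:R *: (B *m F *m invmx B).
Proof.
move=> JB /Nomura1_intertwines EF; have [B2 _ _] := JB.
have := intertwines_conj JB EF.
(* Now [(tau F)^T] acts on the eigenvectors built from [B^T], and conjugation by [B^T] brings it
   back to those of [N]. *)
move=> /(exchange n_neq0 _ _ _ _ (type_II_inv B2) (proj1 B2)).
rewrite schur_invK tr_schur_inv.
by move=> /(intertwines_conjV (Jones_data_tr JB))/intertwines_Nomura1.
Qed.

Lemma Nomura1_conj B F : Jones_data B -> N F -> N (B *m F *m invmx B).
Proof.
move=> JB NF; have [Nd td] := Nomura1_conj_dual JB NF.
have [] := Nomura1_Theta1 Nd; rewrite td => Nn _.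
by have [] := Nomura1_scale n%:R^-1 Nn; rewrite scalerA mulVf // scale1r.
Qed.

(** The two conjugations differ by one with [B^T *m B = B *m B^T], an element of the commutative
    algebra [N]. *)
Lemma Jones_conj_tr B F : Jones_data B -> N F ->
  invmx B^T *m F *m B^T = B *m F *m invmx B.
Proof.
move=> JB NF; have [B2 _ _] := JB; have uB := type_II_unit n_neq0 B2.
have uBt : B^T \in unitmx by rewrite unitmx_tr.
have [NC _] := Nomura1_mulmx_tr JB; have Ns := Nomura1_conj JB NF.
apply: (can_inj (mulKmx uBt)); rewrite -!mulmxA mulKVmx //.
apply: (can_inj (mulmxK uB)).
rewrite -!mulmxA mulVmx // mulmx1 [in RHS]mulmxA -Jones_mulmx_trC //.
exact/esym/Nomura1_comm.
Qed.

(** [Nomura1_conj_dual] is applied to [tau F], whose own image [n F^T] turns the inner matrix into a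
    conjugate of [F]. *)
Lemma Theta1_conj B F : Jones_data B -> N F ->
  tau (B *m F *m invmx B) = B *m tau F *m invmx B.
Proof.
move=> JB NF; have [NT TT] := Nomura1_Theta1 NF.
have [_] := Nomura1_conj_dual JB NT; rewrite TT linearZ /= trmxK.
rewrite -scalemxAr -scalemxAl Jones_conj_tr //.
by have [_ ->] := Nomura1_scale n%:R (Nomura1_conj JB NF) => /(scalerI n_neq0).
Qed.

End NomuraSymmetric.

(** * The doubled blocks *)

Section Doubling.
Variables (K : fieldType) (n : nat).
Implicit Types X Y : 'M[K]_n.

(** This is the Kronecker sum [J (x) X + Z (x) Y], where [J] is all-ones of order 2 and [Z] has rows
    [(1, -1)] and [(-1, 1)]. From [J Z = Z J = 0], [J^2 = 2 J], [Z^2 = 2 Z] and [Z o Z = J] come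
    both product rules. *)
Definition double_mx X Y : 'M[K]_(n + n) :=
  block_mx (X + Y) (X - Y) (X - Y) (X + Y).

Lemma double_mx_linear a X Y X' Y' :
  a *: double_mx X Y + double_mx X' Y' = double_mx (a *: X + X') (a *: Y + Y').
Proof.
rewrite /double_mx scale_block_mx add_block_mx !scalerDr !scalerN !opprD.
by congr block_mx; rewrite addrACA.
Qed.

Lemma double_mx0 : double_mx 0 0 = 0.
Proof. by rewrite /double_mx subr0 addr0 block_mx0. Qed.

Lemma tr_double_mx X Y : (double_mx X Y)^T = double_mx X^T Y^T.
Proof. by rewrite /double_mx tr_block_mx !linearD !linearN. Qed.

Lemma double_mx_add X Y X' Y' :
  double_mx X Y + double_mx X' Y' = double_mx (X + X') (Y + Y').
Proof. by have := double_mx_linear 1 X Y X' Y'; rewrite !scale1r. Qed.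

Lemma mul_double_mx X Y X' Y' :
  double_mx X Y *m double_mx X' Y' =
  double_mx (2%:R *: (X *m X')) (2%:R *: (Y *m Y')).
Proof.
rewrite /double_mx mulmx_block !mulmxDl !mulmxDr !mulNmx !mulmxN !opprK.
by congr block_mx; apply/matrixP => i j; rewrite !mxE; ring.
Qed.

Lemma schur_block_mx m1 m2 n1 n2 (P P' : 'M[K]_(m1, n1)) (Q Q' : 'M[K]_(m1, n2))
    (S S' : 'M[K]_(m2, n1)) (T T' : 'M[K]_(m2, n2)) :
  schur (block_mx P Q S T) (block_mx P' Q' S' T') =
  block_mx (schur P P') (schur Q Q') (schur S S') (schur T T').
Proof.
apply/matrixP => p q; rewrite !mxE; case: (split p) => p'; rewrite !mxE;
by case: (split q) => q'; rewrite !mxE.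
Qed.

Lemma schur_double_mx X Y X' Y' :
  schur (double_mx X Y) (double_mx X' Y') =
  double_mx (schur X X' + schur Y Y') (schur X Y' + schur Y X').
Proof.
rewrite /double_mx schur_block_mx.
by congr block_mx; apply/matrixP => i j; rewrite !mxE; ring.
Qed.

Lemma double_mx_inj X Y : 2%:R != 0 :> K -> double_mx X Y = 0 -> X = 0 /\ Y = 0.
Proof.
move=> two0; rewrite -block_mx0 => /eq_block_mx[E1 E2 _ _].
have XY : X = Y by apply/eqP; rewrite -subr_eq0 E2.
have X0 : X = 0.
  by apply: (scalerI two0); rewrite scaler0 scaler_nat mulr2n {2}XY.
by rewrite -XY X0.
Qed.

End Doubling.

(** * The space [N_{A,B}] as [A o N] *)

Section NomuraAB.
Variables (K : fieldType) (n : nat).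
Hypotheses (n_neq0 : n%:R != 0 :> K).
Variables A B : 'M[K]_n.
Hypotheses (hA : A^T = A) (A2 : type_II A) (JB : Jones_data A B).
Implicit Types G V : 'M[K]_n.
Let A0 : no_zero_entry A := proj1 A2.
Let B0 : no_zero_entry B.
Proof. by have [[]] := JB. Qed.

(** After [exchange], the claim concerns the composite of [n^-1 tau V^T], an element of [N] with
    scalars [V], and [B^T], whose scalars are [n A]. *)
Lemma Nomura_schur V : Nomura1 A V ->
  Nomura A B (schur A V) /\
  Theta A B (schur A V) = n%:R^-1 *: Theta1 A V *m B.
Proof.
move=> NV; apply: intertwines_Nomura => //.
apply/(exchange n_neq0 _ _ _ _ A2 B0).
have [NVt tVt] := Nomura1_tr n_neq0 hA A2 NV.
have [Nt tt] := Nomura1_Theta1 n_neq0 hA A2 NVt.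
have [NF tF] := Nomura1_scale A2 n%:R^-1 Nt.
have := intertwines_comp (Nomura1_intertwines NF)
  (Jones_intertwines_tr n_neq0 hA A2 JB).
rewrite tF tt trmxK scalerA mulVf // scale1r schurZr schurC tVt.
by rewrite trmx_mul !linearZ /= (tr_schur_inv A) hA.
Qed.

(** Composing the exchanged relation of [G] with the inverse of [B^T] gives an element of [N] whose
    [tau]-image is [schur A' G]. *)
Lemma Nomura_schur_inv G : Nomura A B G -> Nomura1 A (schur (schur_inv A) G).
Proof.
move=> /Nomura_intertwines; have [B2 _ _] := JB.
move=> /(exchange n_neq0 _ _ _ _ A2 B0); rewrite (tr_schur_inv A) hA => E.
have uBt : B^T \in unitmx by rewrite unitmx_tr; apply: type_II_unit.
have J := intertwines_inv uBt (scaled_neq0 n_neq0 A2)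
  (Jones_intertwines_tr n_neq0 hA A2 JB).
have [NF tF] := intertwines_Nomura1 A2 (intertwines_comp E J).
have [+ _] := Nomura1_Theta1 n_neq0 hA A2 NF; rewrite tF; congr (Nomura1 A _).
by apply/matrixP => i j; rewrite !mxE; field; rewrite n_neq0 A0.
Qed.

End NomuraAB.

(** * The block matrices in terms of [N], their closure properties and dimension *)

Section BoseMesnerBspace.
Variables (K : fieldType) (n : nat).
Hypotheses (n_neq0 : n%:R != 0 :> K) (two_neq0 : 2%:R != 0 :> K).
Variables A B : 'M[K]_n.
Hypotheses (hA : A^T = A) (A2 : type_II A) (JB : Jones_data A B).
Implicit Types F G H L T U V W : 'M[K]_n.

Local Notation A' := (schur_inv A).
Local Notation N := (Nomura1 A).
Local Notation tau := (Theta1 A).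

Let A0 : no_zero_entry A := proj1 A2.
Let uB : B \in unitmx.
Proof. by have [B2 _ _] := JB; apply: type_II_unit. Qed.
Let JBt := Jones_data_tr n_neq0 JB.
Let B0 : no_zero_entry B.
Proof. by have [[]] := JB. Qed.

(** On [N] this is also conjugation by [B^T] ([rhoE]), hence its compatibility with
    transposition. *)
Definition rho F := invmx B *m F *m B.

Lemma rhoE F : N F -> rho F = B^T *m F *m invmx B^T.
Proof.
by move=> NF; rewrite -(Jones_conj_tr n_neq0 hA A2 JBt NF) !trmxK.
Qed.

Lemma Nomura1_rho F : N F -> N (rho F).
Proof. by move=> NF; rewrite rhoE //; apply: Nomura1_conj JBt NF. Qed.

Lemma Theta1_rho F : N F -> tau (rho F) = rho (tau F).
Proof.
move=> NF; have [NT _] := Nomura1_Theta1 n_neq0 hA A2 NF.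
by rewrite !rhoE //; apply: Theta1_conj JBt NF.
Qed.

Lemma tr_rho F : N F -> (rho F)^T = rho F^T.
Proof.
move=> NF; have [NFT _] := Nomura1_tr n_neq0 hA A2 NF.
by rewrite (rhoE NFT) /rho !trmx_mul trmx_inv mulmxA.
Qed.

Lemma rho_linear : linear rho.
Proof.
by move=> a F G; rewrite /rho mulmxDr mulmxDl -scalemxAr -scalemxAl.
Qed.

Lemma rhoM F G : rho (F *m G) = rho F *m rho G.
Proof. by rewrite /rho !mulmxA mulmxK. Qed.

Lemma rho1 : rho 1%:M = 1%:M.
Proof. by rewrite /rho mulmx1 mulVmx. Qed.

Lemma rhoD F G : rho (F + G) = rho F + rho G.
Proof. by have := rho_linear 1 F G; rewrite !scale1r. Qed.

Lemma rhoZ a F : rho (a *: F) = a *: rho F.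
Proof. by rewrite /rho -scalemxAr -scalemxAl. Qed.

(** Through [tau] the Schur product comes from an ordinary product, which conjugation respects. *)
Lemma rho_schur F G : N F -> N G -> rho (schur F G) = schur (rho F) (rho G).
Proof.
move=> /(Theta1_surj n_neq0 hA A2)[F' NF <-].
move=> /(Theta1_surj n_neq0 hA A2)[G' NG <-].
have [NFG <-] := Nomura1_mul A2 NF NG; rewrite -!Theta1_rho // rhoM.
have [_ <- //] := Nomura1_mul A2 (Nomura1_rho NF) (Nomura1_rho NG).
Qed.

Lemma Nomura1_schurAA : N (schur A A) /\ rho (schur A A) = schur A A.
Proof.
have [NC tC] := Nomura1_mulmx_tr n_neq0 hA A2 JB.
have AA : schur A A = n%:R ^- 2 *: tau (B *m B^T).
  by rewrite tC scalerA mulVf ?expf_neq0 // scale1r.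
have [NtC _] := Nomura1_Theta1 n_neq0 hA A2 NC.
have [NAA _] := Nomura1_scale A2 (n%:R ^- 2) NtC.
rewrite {2 3}AA rhoZ -Theta1_rho // AA; split=> //.
congr (_ *: tau _).
by rewrite /rho mulKmx // (Jones_mulmx_trC n_neq0 hA A2 JB).
Qed.

(** Conjugation by [B] sends [rho F] back to [F] and keeps the scalars [tau (rho F)]. *)
Lemma rho_Theta_schur_inv F : N F -> Theta1 (schur_inv B) F = rho (tau F).
Proof.
move=> NF; have NrF := Nomura1_rho NF; rewrite -Theta1_rho //.
have := intertwines_conj n_neq0 hA A2 JB (Nomura1_intertwines NrF).
rewrite /rho !mulmxA mulmxV // mul1mx mulmxK // => E.
rewrite /Theta1 schur_invK.
by have [] := intertwines_Nomura (schur_inv_neq0 B0) B0 E.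
Qed.

Lemma Nomura_comm F G : Nomura A B F -> Nomura A B G -> F *m G = G *m F.
Proof.
move=> NF NG; have [NFG tFG] := Nomura_mul A0 B0 NF NG.
have [NGF tGF] := Nomura_mul A0 B0 NG NF.
by apply: (Theta_inj n_neq0 A2 B0) => //; rewrite tFG tGF schurC.
Qed.

Lemma is_paired_unique H L L' :
  is_paired A B H L -> is_paired A B H L' -> L = L'.
Proof.
move=> [NL EL] [NL' EL']; apply: trmx_inj.
apply: (Theta_inj n_neq0 A2 (tr_neq0 B0) NL NL').
by apply: trmx_inj; rewrite -EL -EL'.
Qed.

(** Both sides of the pairing equation are [n^-1 tau V *m B], because
    [B *m rho (tau V) = tau V *m B]. *)
Lemma is_paired_schur V : N V ->
  is_paired A B (schur A V) (schur A (rho V)).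
Proof.
move=> NV; have NrV := Nomura1_rho NV.
have [NrVt trVt] := Nomura1_tr n_neq0 hA A2 NrV.
have [_ tG] := Nomura_schur n_neq0 hA A2 JB NV.
have [NG tGt] := Nomura_schur n_neq0 hA A2 JBt NrVt.
rewrite /is_paired tr_schur hA; split=> //.
rewrite tG tGt trmx_mul trmxK linearZ /= trVt trmxK Theta1_rho //.
by rewrite /rho -scalemxAl -scalemxAr !mulmxA mulmxV // mul1mx.
Qed.

Lemma paired_schur V : N V -> paired A B (schur A V) = schur A (rho V).
Proof.
move=> NV; have pV := is_paired_schur NV; rewrite /paired.
by case: xgetP => [L _ /is_paired_unique/(_ pV)|/(_ _ pV)].
Qed.

Lemma is_paired_mul H H' L L' : Nomura A B H -> Nomura A B H' ->
  is_paired A B H L -> is_paired A B H' L' ->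
  is_paired A B (H *m H') (L' *m L).
Proof.
move=> NH NH' [NL EL] [NL' EL']; rewrite /is_paired trmx_mul.
have [_ ->] := Nomura_mul A0 B0 NH NH'.
have [NLL ->] := Nomura_mul A0 (tr_neq0 B0) NL NL'.
by rewrite tr_schur EL EL'.
Qed.

(** One [W] serves both products: pairing is multiplicative up to the order of the factors, which
    commute, and the paired matrix is unique. *)
Lemma schur_mul_closed V V' : N V -> N V' ->
  exists W, [/\ N W, schur A V *m schur A V' = schur A W
    & schur A (rho V) *m schur A (rho V') = schur A (rho W)].
Proof.
move=> NV NV'.
have [NG tG] := Nomura_schur n_neq0 hA A2 JB NV.
have [NG' tG'] := Nomura_schur n_neq0 hA A2 JB NV'.
have [NGG _] := Nomura_mul A0 B0 NG NG'.
have NW := Nomura_schur_inv n_neq0 hA A2 JB NGG.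
have GW := schurK (schur A V *m schur A V') A0.
exists (schur A' (schur A V *m schur A V')); split=> //.
have [NK _] := Nomura_schur n_neq0 hA A2 JB (Nomura1_rho NV).
have [NK' _] := Nomura_schur n_neq0 hA A2 JB (Nomura1_rho NV').
rewrite (Nomura_comm NK NK').
have pW := is_paired_schur NW; rewrite GW in pW.
apply: is_paired_unique pW.
by apply: is_paired_mul => //; apply: is_paired_schur.
Qed.

(** With [U = n^-1 tau V], the two kinds of block are [Theta]-images of [schur A V] and of its
    transpose, and [Theta] turns products into Schur products. *)
Lemma schur_mulB_closed U U' : N U -> N U' ->
  exists U'', [/\ N U'', schur (U *m B) (U' *m B) = U'' *m B
    & schur (B^T *m U) (B^T *m U') = B^T *m U''].
Proof.
have lift X : N X -> exists2 V, N V & X = n%:R^-1 *: tau V.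
  move=> NX; have [NnX _] := Nomura1_scale A2 n%:R NX.
  have [V NV tV] := Theta1_surj n_neq0 hA A2 NnX.
  by exists V; rewrite // tV scalerA mulVf // scale1r.
have tr_lift V : N V -> (Theta A B (schur A V)^T)^T = B^T *m (n%:R^-1 *: tau V).
  move=> NV; have [NVt tVt] := Nomura1_tr n_neq0 hA A2 NV.
  have [_] := Nomura_schur n_neq0 hA A2 JB NVt.
  by rewrite tr_schur hA tVt => ->; rewrite trmx_mul linearZ /= trmxK.
move=> /lift[V NV ->] /lift[V' NV' ->].
have [W [NW VW _]] := schur_mul_closed NV NV'.
have [NtW _] := Nomura1_Theta1 n_neq0 hA A2 NW.
have [NU _] := Nomura1_scale A2 n%:R^-1 NtW.
exists (n%:R^-1 *: tau W); split=> //.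
  have [NG <-] := Nomura_schur n_neq0 hA A2 JB NV.
  have [NG' <-] := Nomura_schur n_neq0 hA A2 JB NV'.
  have [_ <-] := Nomura_schur n_neq0 hA A2 JB NW.
  by rewrite -VW; have [_ ->] := Nomura_mul A0 B0 NG NG'.
rewrite -!tr_lift // -VW trmx_mul -tr_schur; congr _^T.
have NGt X : N X -> Nomura A B (schur A X)^T.
  move=> NX; have [NXt _] := Nomura1_tr n_neq0 hA A2 NX.
  by rewrite tr_schur hA; have [] := Nomura_schur n_neq0 hA A2 JB NXt.
have [_ ->] := Nomura_mul A0 B0 (NGt _ NV') (NGt _ NV).
exact: schurC.
Qed.

(** The parameters are [T = tau F], [U = n^-1 tau (A' o G)] and [V = A' o H]; they range
    independently over [N]. *)
Definition Mb T U V : 'M[K]_(n + n + (n + n)) :=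
  block_mx (double_mx T (schur A V)) (double_mx (U *m B) 0)
           (double_mx (B^T *m U) 0) (double_mx (rho T) (schur A (rho V))).

Lemma Mb_linear a T U V T' U' V' :
  a *: Mb T U V + Mb T' U' V' = Mb (a *: T + T') (a *: U + U') (a *: V + V').
Proof.
rewrite /Mb scale_block_mx add_block_mx !double_mx_linear !rho_linear.
by rewrite !schur_linear mulmxDl mulmxDr -scalemxAl -scalemxAr scaler0 addr0.
Qed.

Lemma Bspace_Mb X : Bspace A B X <->
  exists T U V, [/\ N T, N U, N V & X = Mb T U V].
Proof.
have MbE F V V' : N F -> N V -> N V' ->
    Mblock A B F (schur A V) (schur A V') =
    Mb (tau F) (n%:R^-1 *: tau V) V'.
  move=> NF NV NV'; have [NVt tVt] := Nomura1_tr n_neq0 hA A2 NV.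
  have [_ tG] := Nomura_schur n_neq0 hA A2 JB NV.
  have [_ tGt] := Nomura_schur n_neq0 hA A2 JB NVt.
  rewrite /Mblock /Mb /double_mx paired_schur // rho_Theta_schur_inv //.
  rewrite tr_schur hA tG tGt tVt trmx_mul [(_ *: _^T)^T]linearZ /= trmxK.
  by rewrite !addr0 !subr0.
split=> [[F [G [H [NF NG NH ->]]]]|[T [U [V [NT NU NV ->]]]]].
  have NG' := Nomura_schur_inv n_neq0 hA A2 JB NG.
  have NH' := Nomura_schur_inv n_neq0 hA A2 JB NH.
  exists (tau F), (n%:R^-1 *: tau (schur A' G)), (schur A' H).
  have [NtF _] := Nomura1_Theta1 n_neq0 hA A2 NF.
  have [NtG _] := Nomura1_Theta1 n_neq0 hA A2 NG'.
  have [NU _] := Nomura1_scale A2 n%:R^-1 NtG.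
  by split=> //; rewrite -MbE // !schurK.
have [F NF tF] := Theta1_surj n_neq0 hA A2 NT.
have [NnU _] := Nomura1_scale A2 n%:R NU.
have [V' NV' tV'] := Theta1_surj n_neq0 hA A2 NnU.
exists F, (schur A V'), (schur A V).
have [NG _] := Nomura_schur n_neq0 hA A2 JB NV'.
have [NH _] := Nomura_schur n_neq0 hA A2 JB NV.
by split=> //; rewrite MbE // tF tV' scalerA mulVf // scale1r.
Qed.

(** Parameters for [I] and [J]: the identity is paired with itself, and its [Theta]-image is
    all-ones. *)
Lemma Nomura_schur_inv1 : let V := schur A' 1%:M in
  [/\ N V, schur A V = 1%:M, schur A (rho V) = 1%:M,
      n%:R^-1 *: tau V *m B = const_mx 1
    & B^T *m (n%:R^-1 *: tau V) = const_mx 1].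
Proof.
move=> V; have [N1 t1] := intertwines_Nomura A0 B0 (intertwines1 A B).
have NV := Nomura_schur_inv n_neq0 hA A2 JB N1; rewrite -/V in NV.
have AV : schur A V = 1%:M by rewrite schurK.
have [N1' t1'] := intertwines_Nomura A0 (tr_neq0 B0) (intertwines1 A B^T).
have tU : n%:R^-1 *: tau V *m B = const_mx 1.
  by have [_ <-] := Nomura_schur n_neq0 hA A2 JB NV; rewrite AV.
split=> //.
  have := is_paired_schur NV; rewrite AV => /is_paired_unique; apply.
  by rewrite /is_paired tr_scalar_mx t1 t1' trmx_const.
(* [V] is diagonal, so the last claim is the transpose of the one before. *)
have Vt : V^T = V.
  apply/matrixP => i j; rewrite !mxE eq_sym; case: eqVneq => [->//|].
  by rewrite !mulr0.
have [_] := Nomura1_tr n_neq0 hA A2 NV; rewrite Vt => tVt.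
by rewrite tVt -[LHS]trmxK trmx_mul linearZ /= !trmxK tU trmx_const.
Qed.

(** The blocks match through [B *m rho T = T *m B] and [rho T *m B^T = B^T *m T], together with
    [B *m B^T] being in the commutative [N]. *)
Lemma Mb_mul T U V T' U' V' : N T -> N U -> N V -> N T' -> N U' -> N V' ->
  exists W, [/\ N W, schur A V *m schur A V' = schur A W &
  Mb T U V *m Mb T' U' V' =
  Mb (2%:R *: (T *m T' + U *m (B *m B^T) *m U'))
     (2%:R *: (T *m U' + U *m T')) (2%:R *: W)].
Proof.
move=> NT NU NV NT' NU' NV'.
have [W [NW VW rW]] := schur_mul_closed NV NV'; exists W; split=> //.
have [NC _] := Nomura1_mulmx_tr n_neq0 hA A2 JB.
rewrite /Mb mulmx_block !mul_double_mx !double_mx_add.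
rewrite !(mul0mx, mulmx0) !scaler0 !addr0 !add0r VW rW !rhoZ !schurZr.
have C : B *m B^T = B^T *m B := Jones_mulmx_trC n_neq0 hA A2 JB.
congr block_mx; congr double_mx; rewrite -?scalerDr;
  rewrite -?scalemxAl -?scalemxAr; congr (_ *: _).
- by rewrite !mulmxA.
- by rewrite mulmxDl /rho !mulmxA mulmxK.
- rewrite mulmxDr addrC; congr (_ + _); last by rewrite mulmxA.
  rewrite rhoE // -!mulmxA; congr (_ *m _).
  by rewrite mulKmx ?unitmx_tr.
- rewrite rhoD rhoM addrC; congr (_ + _).
  by rewrite /rho (Nomura1_comm n_neq0 A2 NU NC) !mulmxA mulVmx // mul1mx.
Qed.

(** The lower right corner fits because [rho] respects Schur products and fixes [schur A A]. *)
Lemma Mb_schur T U V T' U' V' : N T -> N U -> N V -> N T' -> N U' -> N V' ->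
  exists U'', N U'' /\
  schur (Mb T U V) (Mb T' U' V') =
  Mb (schur T T' + schur (schur A A) (schur V V')) U''
     (schur T V' + schur V T').
Proof.
move=> NT NU NV NT' NU' NV'.
have [U'' [NU'' EU EU']] := schur_mulB_closed NU NU'; exists U''; split=> //.
have [NAA rAA] := Nomura1_schurAA.
have Ns := Nomura1_schur n_neq0 hA A2.
rewrite /Mb schur_block_mx !schur_double_mx !schur0 !addr0.
rewrite ![schur 0 _]schurC !schur0 EU EU' !addr0 !rhoD.
rewrite (rho_schur NAA (Ns _ _ NV NV')) rAA !rho_schur //.
congr block_mx; congr double_mx;
  by apply/matrixP => i j; rewrite !mxE; ring.
Qed.

Lemma Bspace_Bose_Mesner : Bose_Mesner (Bspace A B).
Proof.
have Nlin a X Y : N X -> N Y -> N (a *: X + Y).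
  by move=> NX NY; have [] := Nomura1_linear A2 a NX NY.
have NZ a X : N X -> N (a *: X).
  by move=> NX; have [] := Nomura1_scale A2 a NX.
have Nadd := Nomura1_add A2.
have Ntr X : N X -> N X^T by move=> NX; have [] := Nomura1_tr n_neq0 hA A2 NX.
have Nmul X Y : N X -> N Y -> N (X *m Y).
  by move=> NX NY; have [] := Nomura1_mul A2 NX NY.
have Ncomm := Nomura1_comm n_neq0 A2.
have Nsch := Nomura1_schur n_neq0 hA A2.
have N0 := Nomura1_0 A2.
have [N1 t1] := Nomura1_1 A2.
have [NJ _] := Nomura1_Theta1 n_neq0 hA A2 N1; rewrite t1 in NJ.
have rJ : rho (const_mx 1) = const_mx 1 by rewrite -t1 -Theta1_rho // rho1.
have [NV AV ArV UB BU] := Nomura_schur_inv1.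
have [NtV _] := Nomura1_Theta1 n_neq0 hA A2 NV.
have rho0 : rho 0 = 0 by rewrite /rho mulmx0 mul0mx.
split.
- split.
    apply/Bspace_Mb; exists 0, 0, 0; split=> //.
    by rewrite /Mb mul0mx mulmx0 rho0 !schur0 !double_mx0 block_mx0.
  move=> a X Y /Bspace_Mb[T [U [V [NT NU NV1 ->]]]].
  move=> /Bspace_Mb[T' [U' [V' [NT' NU' NV' ->]]]]; apply/Bspace_Mb.
  by exists (a *: T + T'), (a *: U + U'), (a *: V + V'); split;
     rewrite ?Mb_linear; auto.
- split; apply/Bspace_Mb.
    (* Equal components cancel off the diagonal in [double_mx] and add up on it, hence the
       halves. *)
    exists (2%:R^-1 *: 1%:M), 0, (2%:R^-1 *: schur A' 1%:M); split; auto.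
    rewrite /Mb !rhoZ !schurZr AV ArV mul0mx mulmx0 double_mx0 rho1.
    have -> : double_mx (2%:R^-1 *: 1%:M) (2%:R^-1 *: 1%:M) =
        1%:M :> 'M[K]_(n + n).
      rewrite /double_mx subrr -scalerDl -mulr2n -[_^-1 *+ _]mulr_natl.
      by rewrite divff // scale1r -scalar_mx_block.
    by rewrite -scalar_mx_block.
  exists (const_mx 1), (n%:R^-1 *: tau (schur A' 1%:M)), 0; split; auto.
  rewrite /Mb rJ UB BU rho0 schur0 /double_mx addr0 subr0.
  by rewrite !block_mx_const.
- move=> X /Bspace_Mb[T [U [V [NT NU NV1 ->]]]]; apply/Bspace_Mb.
  exists T^T, U^T, V^T; split; auto.
  rewrite /Mb tr_block_mx !tr_double_mx !tr_schur !tr_rho // hA trmx0.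
  by rewrite [(B^T *m U)^T]trmx_mul [(U *m B)^T]trmx_mul trmxK.
- move=> X Y /Bspace_Mb[T [U [V [NT NU NV1 ->]]]].
  move=> /Bspace_Mb[T' [U' [V' [NT' NU' NV' ->]]]]; apply/Bspace_Mb.
  have [U'' [NU'' ->]] := Mb_schur NT NU NV1 NT' NU' NV'.
  have [NAA _] := Nomura1_schurAA.
  exists (schur T T' + schur (schur A A) (schur V V')), U'',
    (schur T V' + schur V T').
  by split; auto.
- move=> X Y /Bspace_Mb[T [U [V [NT NU NV1 ->]]]].
  move=> /Bspace_Mb[T' [U' [V' [NT' NU' NV' ->]]]].
  have [W [NW VW E]] := Mb_mul NT NU NV1 NT' NU' NV'.
  have [W' [NW' VW' E']] := Mb_mul NT' NU' NV' NT NU NV1.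
  have [NC _] := Nomura1_mulmx_tr n_neq0 hA A2 JB.
  split.
    apply/Bspace_Mb; exists (2%:R *: (T *m T' + U *m (B *m B^T) *m U')),
      (2%:R *: (T *m U' + U *m T')), (2%:R *: W).
    by split; auto.
  (* [schur A W] and [schur A W'] are the two orders of a product in the commutative [N_{A,B}]. *)
  have WW : W = W'.
    rewrite -(schurVK W A0) -(schurVK W' A0) -VW -VW'; congr schur.
    have [NG _] := Nomura_schur n_neq0 hA A2 JB NV1.
    have [NG' _] := Nomura_schur n_neq0 hA A2 JB NV'.
    exact: Nomura_comm.
  have TE : T *m T' + U *m (B *m B^T) *m U' = T' *m T + U' *m (B *m B^T) *m U.
    rewrite (Ncomm _ _ NT NT') (Ncomm _ _ NU NC) (Ncomm _ _ NU' NC) -2!mulmxA.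
    by rewrite -[in RHS]mulmxA -[in RHS]mulmxA (Ncomm _ _ NU NU').
  have UE : T *m U' + U *m T' = T' *m U + U' *m T.
    by rewrite addrC (Ncomm _ _ NU NT') (Ncomm _ _ NT NU').
  by rewrite E E' WW TE UE.
Qed.

(** The three parameters are recovered from the upper blocks by halving, inverting [B] and dividing
    by the entries of [A]. *)
Lemma Bspace_has_dim d : has_dim N d -> has_dim (Bspace A B) (3 * d)%N.
Proof.
have rho0 : rho 0 = 0 by rewrite /rho mulmx0 mul0mx.
have MbE T U V : Mb T 0 0 + Mb 0 U 0 + Mb 0 0 V = Mb T U V.
  have := Mb_linear 1 T 0 0 0 U 0; rewrite !scale1r => ->.
  have := Mb_linear 1 (T + 0) (0 + U) (0 + 0) 0 0 V; rewrite !scale1r => ->.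
  by rewrite !addr0 !add0r.
have lin1 : linear (fun T => Mb T 0 0).
  by move=> a T T'; rewrite Mb_linear scaler0 addr0.
have lin2 : linear (fun U => Mb 0 U 0).
  by move=> a U U'; rewrite Mb_linear scaler0 addr0.
have lin3 : linear (fun V => Mb 0 0 V).
  by move=> a V V'; rewrite Mb_linear scaler0 addr0.
move=> /(has_dim_image3 lin1 lin2 lin3)[T U V|X [XE dimX]].
  rewrite MbE /Mb -(block_mx0 K (n + n) (n + n) (n + n) (n + n)).
  move=> /eq_block_mx[/(double_mx_inj two_neq0)[-> AV]].
  move=> /(double_mx_inj two_neq0)[UB _] _ _; split=> //.
    by apply: (can_inj (mulmxK uB)); rewrite UB mul0mx.
  by rewrite -(schurVK V A0) AV schur0.
exists X; split=> // M; rewrite XE Bspace_Mb; split.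
  by move=> [T [U [V [NT NU NV ->]]]]; exists T, U, V; rewrite MbE.
by move=> [T [U [V [NT NU NV ->]]]]; exists T, U, V; rewrite MbE.
Qed.

End BoseMesnerBspace.

Theorem theorem6p7 (R : realType) (n : nat) (A B : 'M[complex R]_n)
    (hJP : invertible_Jones_pair A B) (hA : A^T = A) :
  Bose_Mesner (Bspace A B) /\
  exists d : nat, has_dim (Nomura1 A) d /\ has_dim (Bspace A B) (3 * d)%N.
Proof.
(* Order 0 is separate, since [n] must be invertible later; there all matrices are zero and both
   dimensions are 0. *)
case: n => [|n] in A B hJP hA *.
  have BE X : Bspace A B X.
    exists 0, 0, 0; split; try by case.
    by apply/matrixP; case.
  split.
    split=> //; split=> //.
    by apply/matrixP; case.
  exists 0%N; split; exists 0%VS; split; rewrite ?dimv0 // => X; split.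
  - by move=> _ [].
  - by move=> _; rewrite memv0; apply/eqP/matrixP; case.
  - by move=> _; exact: BE.
  - by move=> _; rewrite memv0; apply/eqP/matrixP; case.
have n0 : n.+1%:R != 0 :> complex R by rewrite pnatr_eq0.
have two0 : 2%:R != 0 :> complex R by rewrite pnatr_eq0.
have [A2 B2 E1 E2] := invertible_Jones_pair_type_II n0 hJP.
have JB : Jones_data A B by [].
split; first exact: Bspace_Bose_Mesner.
have [|V VE] := @linear_subspace_vspace _ _ (Nomura1 A).
  split; first exact: Nomura1_0 A2.
  by move=> a X Y NX NY; have [] := Nomura1_linear A2 a NX NY.
have dN : has_dim (Nomura1 A) (\dim V) by exists V.
by exists (\dim V); split=> //; apply: Bspace_has_dim.
Qed.
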